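(* Let $n\ge1$, $L>0$, and let $f:\mathbb R^n\to\mathbb R$ be convex and continuously differentiable with $L$-Lipschitz gradient. Let $\eta\in(0,\frac{1}{2L}]$, $p\ge 3$, $\alpha_k=\frac{p}{k+p}$ and $\epsilon_k=2^{-k}$ for $k\in\mathbb N=\{0,1,2,\dots\}$, and let $\mu>0$. Suppose $f$ has a minimizer $\mathbf{x}^*\in\mathbb B_\mu$. Let $(\mathbf{x}_k)$ be generated by the zeroth-order NSA algorithm with projection onto $\mathbb B_\mu$ (described in the context), using the central finite-difference gradient estimator. Then either $$\liminf_{k\to\infty}\beta^k\|\nabla f(\mathbf{x}_k)\|=0\quad\text{for some }\beta>1,$$ or $$\limsup_{k\to\infty}k^2\,(f(\mathbf{x}_k)-f(\mathbf{x}^* ))=0\quad\text{and}\quad\liminf_{k\to\infty}k^2\log k\,\log\log k\,(f(\mathbf{x}_k)-f(\mathbf{x}^* ))=0.$$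
   Context: $\mathbb B_\mu$ is the closed Euclidean ball of radius $\mu$ centered at the origin and $\Pi_{\mathbb B_\mu}$ the Euclidean projection onto it. The (deterministic) gradient estimator is $$\mathcal G(f,\mathbf{x},\epsilon)=\frac{1}{2\epsilon}\sum_{i=1}^n\big[f(\mathbf{x}+\epsilon\mathbf{e}_i)-f(\mathbf{x}-\epsilon\mathbf{e}_i)\big]\mathbf{e}_i,\qquad \mathbf{x}\in\mathbb R^n,\ \epsilon>0,$$ where $\mathbf{e}_1,\dots,\mathbf{e}_n$ is the canonical basis of $\mathbb R^n$. Algorithm (NSA with inexact gradients, ''Option II''): pick $\mathbf{x}_0=\mathbf{z}_0\in\mathbb R^n$ (such that $\nabla f(\mathbf{x}_0)\ne0$). For $k=0,1,2,\dots$ set $\mathbf{y}_k=(1-\alpha_k)\mathbf{x}_k+\alpha_k\mathbf{z}_k$, $\mathbf{g}_k(\mathbf{x}_k)=\mathcal G(f,\mathbf{x}_k,\epsilon_k)$, $\mathbf{g}_k(\mathbf{y}_k)=\mathcal G(f,\mathbf{y}_k,\epsilon_k)$, $$\mathbf{x}_{k+1}'=\mathbf{y}_k-2\eta\,\mathbf{g}_k(\mathbf{y}_k),\qquad \mathbf{x}_{k+1}''=\mathbf{x}_k-2\eta\,\mathbf{g}_k(\mathbf{x}_k),$$ $$\mathbf{x}_{k+1}=\begin{cases}\mathbf{x}_{k+1}'&\text{if } f(\mathbf{x}_{k+1}')\le f(\mathbf{x}_{k+1}''),\\ \mathbf{x}_{k+1}''&\text{otherwise,}\end{cases}\qquad \mathbf{z}_{k+1}=\Pi_{\mathbb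 B_\mu}\Big(\mathbf{z}_k-\frac{\eta}{\alpha_k}\mathbf{g}_k(\mathbf{y}_k)\Big).$$ *)

(* Defs.v *)
From HB Require Import structures.
From mathcomp Require Import all_boot all_order all_algebra.
From mathcomp Require Import all_classical all_reals all_analysis.

Set Implicit Arguments.
Unset Strict Implicit.
Unset Printing Implicit Defensive.

Import Order.TTheory GRing.Theory Num.Theory.
Import numFieldNormedType.Exports.

Local Open Scope classical_set_scope.
Local Open Scope ring_scope.

(* The library norm `|x| on 'rV[R]_n is the sup norm (it is used below only
   through the topology, i.e. differentiability and continuity), hence a
   separate Euclidean norm. *)
Definition enorm (R : realType) (n : nat) (x : 'rV[R]_n) : R :=
  Num.sqrt (\sum_(i < n) x 0 i ^+ 2).

Definition eball (R : realType) (n : nat) (mu : R) : set 'rV[R]_n :=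
  [set x | enorm x <= mu].
Arguments eball {R} n mu.

(* w is a Euclidean projection of v onto C; on a nonempty closed convex C there
   is exactly one such w. *)
Definition is_eproj (R : realType) (n : nat) (C : set 'rV[R]_n)
    (v w : 'rV[R]_n) : Prop :=
  C w /\ forall u, C u -> enorm (v - w) <= enorm (v - u).

(* Junk-valued where f is not differentiable. *)
Definition grad (R : realType) (n : nat) (f : 'rV[R]_n -> R) (x : 'rV[R]_n) :
    'rV[R]_n :=
  \row_(i < n) 'D_(delta_mx 0 i) f x.

Definition C1 (R : realType) (n : nat) (f : 'rV[R]_n -> R) : Prop :=
  (forall x, differentiable f x) /\ continuous (grad f).

Definition grad_lipschitz (R : realType) (n : nat) (L : R)
    (f : 'rV[R]_n -> R) : Prop :=
  forall x y, enorm (grad f x - grad f y) <= L * enorm (x - y).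

Definition fd_grad (R : realType) (n : nat) (f : 'rV[R]_n -> R)
    (x : 'rV[R]_n) (eps : R) : 'rV[R]_n :=
  (2 * eps)^-1 *:
    \sum_(i < n) (f (x + eps *: delta_mx 0 i) - f (x - eps *: delta_mx 0 i))
                   *: delta_mx 0 i.

(* The sequences x, y, z are a run of the projected accelerated method driven by
   finite-difference gradients, with step parameter eta, projection radius mu,
   extrapolation weights alpha k and finite-difference increments eps k. *)
Record nsa_run (R : realType) (n : nat) (f : 'rV[R]_n -> R) (eta mu : R)
    (alpha eps : nat -> R) (x y z : nat -> 'rV[R]_n) : Prop := NsaRun {
  nsa_init : x 0%N = z 0%N ;
  nsa_init_grad : grad f (x 0%N) != 0 ;
  nsa_y : forall k, y k = (1 - alpha k) *: x k + alpha k *: z k ;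
  nsa_x : forall k,
    let x' := y k - (2 * eta) *: fd_grad f (y k) (eps k) in
    let x'' := x k - (2 * eta) *: fd_grad f (x k) (eps k) in
    x k.+1 = if f x' <= f x'' then x' else x'' ;
  nsa_z : forall k,
    is_eproj (eball n mu)
      (z k - (eta / alpha k) *: fd_grad f (y k) (eps k)) (z k.+1)
}.

(* Main.v *)
(* The second alternative always holds.  With q_k = k + p and
   delta_k = f(x_k) - f(x_min), the quantity
   2 eta k q_k delta_k + p^2 |z_k - x_min|^2 drops at each step by at least
   2 eta (k+1) delta_{k+1}, up to an error O(2^-k q_k^2) caused by the finite
   differences: z_k stays bounded, thanks to the projection, so the inner
   product of the gradient error with z_k - x_min is O(2^-k).  Hence
   sum_k k delta_k converges.  The comparison with the step from x_k makes
   delta_k + c 4^-k nonincreasing, and together these give k^2 delta_k -> 0.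
   The liminf follows from the divergence of sum 1/(k ln k ln ln k). *)
Require Import Defs.
From HB Require Import structures.
From mathcomp Require Import all_boot all_order all_algebra.
From mathcomp Require Import ring lra.
From mathcomp Require Import all_classical all_reals all_analysis.

Set Implicit Arguments.
Unset Strict Implicit.
Unset Printing Implicit Defensive.

Import Order.TTheory GRing.Theory Num.Theory.
Import numFieldNormedType.Exports.

Local Open Scope classical_set_scope.
Local Open Scope ring_scope.

(** * Euclidean inner product and projection onto a ball *)

Definition dot (R : realType) (n : nat) (u v : 'rV[R]_n) : R :=
  \sum_(i < n) u 0 i * v 0 i.

Lemma dotC (R : realType) n (u v : 'rV[R]_n) : dot u v = dot v u.
Proof. by apply: eq_bigr => i _; rewrite mulrC. Qed.

Lemma dotDl (R : realType) n (u v w : 'rV[R]_n) :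
  dot (u + v) w = dot u w + dot v w.
Proof. by rewrite -big_split; apply: eq_bigr => i _; rewrite mxE mulrDl. Qed.

Lemma dotZl (R : realType) n a (u w : 'rV[R]_n) : dot (a *: u) w = a * dot u w.
Proof. by rewrite /dot big_distrr; apply: eq_bigr => i _ /=; rewrite mxE mulrA. Qed.

Lemma dotNl (R : realType) n (u w : 'rV[R]_n) : dot (- u) w = - dot u w.
Proof. by rewrite -scaleN1r dotZl mulN1r. Qed.

Lemma dotDr (R : realType) n (u v w : 'rV[R]_n) :
  dot u (v + w) = dot u v + dot u w.
Proof. by rewrite dotC dotDl !(dotC _ u). Qed.

Lemma dotZr (R : realType) n a (u w : 'rV[R]_n) : dot u (a *: w) = a * dot u w.
Proof. by rewrite dotC dotZl dotC. Qed.

Lemma dotNr (R : realType) n (u w : 'rV[R]_n) : dot u (- w) = - dot u w.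
Proof. by rewrite dotC dotNl dotC. Qed.

Definition dotE := (dotDl, dotDr, dotNl, dotNr, dotZl, dotZr).

Lemma dot_ge0 (R : realType) n (u : 'rV[R]_n) : 0 <= dot u u.
Proof. by apply: sumr_ge0 => i _; rewrite -expr2 sqr_ge0. Qed.

Lemma dot_sqrD (R : realType) n (u v : 'rV[R]_n) :
  dot (u + v) (u + v) = dot u u + 2 * dot u v + dot v v.
Proof. by rewrite !dotE (dotC v u); ring. Qed.

Lemma dot_subZ (R : realType) n (t : R) (u v : 'rV[R]_n) :
  dot (u - t *: v) (u - t *: v) = dot u u - 2 * t * dot v u + t ^+ 2 * dot v v.
Proof. by rewrite !dotE (dotC u v); ring. Qed.

(** Expansion of [s * |u / s - v|^2 >= 0]. With a suitable [s] it stands in for Cauchy-Schwarz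
    throughout. *)
Lemma dot_young (R : realType) n (s : R) (u v : 'rV[R]_n) : 0 < s ->
  2 * dot u v <= dot u u / s + s * dot v v.
Proof.
move=> s0; have := dot_ge0 (s^-1 *: u - v).
rewrite !dotE (dotC v u) => h.
have : 0 <= s * (s^-1 * (s^-1 * dot u u) - s^-1 * dot u v
                 - (s^-1 * dot u v - dot v v)).
  by apply: mulr_ge0; [exact: ltW | lra].
rewrite (_ : s * _ = dot u u / s + s * dot v v - 2 * dot u v); first lra.
by field; rewrite gt_eqF.
Qed.

Lemma enorm_sqr (R : realType) n (u : 'rV[R]_n) : enorm u ^+ 2 = dot u u.
Proof.
rewrite /enorm sqr_sqrtr; first by apply: eq_bigr => i _; rewrite expr2.
by apply: sumr_ge0 => i _; rewrite sqr_ge0.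
Qed.

Lemma enorm_le (R : realType) n (u : 'rV[R]_n) (a : R) : 0 <= a ->
  (enorm u <= a) = (dot u u <= a ^+ 2).
Proof. by move=> a0; rewrite -enorm_sqr ler_sqr// nnegrE sqrtr_ge0. Qed.

(** The variational inequality [dot (v - w) (c - w) <= 0] suffices, by expanding
    [|(v - w) - (c - w)|^2]. If it failed, moving [w] slightly towards [c] would stay in the convex
    ball and come closer to [v]. *)
Lemma eproj_nonexpansive (R : realType) n (mu : R) (v w c : 'rV[R]_n) :
  0 <= mu -> eball n mu c -> is_eproj (eball n mu) v w ->
  dot (w - c) (w - c) <= dot (v - c) (v - c).
Proof.
rewrite /eball /= => mu0 cB [wB wmin].
move: wB cB wmin; rewrite /= !enorm_le// => wB cB wmin.
have vwc : dot (v - w) (c - w) <= 0.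
  rewrite leNgt; apply/negP => h.
  pose q := dot (c - w) (c - w).
  have q0 : 0 <= q by exact: dot_ge0.
  (* With [d = dot (v - w) (c - w) > 0], this step satisfies [t * q < 2 * d] even when [q = 0], so
     [-2 * t * d + t^2 * q], the change of the squared distance to [v], is negative. *)
  pose t := dot (v - w) (c - w) / (q + dot (v - w) (c - w)).
  have t01 : 0 < t <= 1.
    by rewrite divr_gt0 ?ltr_wpDl//= ler_pdivrMr ?ltr_wpDl// mul1r lerDr.
  have tq : t * q < 2 * dot (v - w) (c - w).
    rewrite mulrAC ltr_pdivrMr ?ltr_wpDl//.
    have d2 := mulr_gt0 h h; have dq := mulr_ge0 (ltW h) q0; nra.
  have uB : enorm (w + t *: (c - w)) <= mu.
    rewrite enorm_le//; have := dot_ge0 (c - w).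
    have /andP[t0 t1] := t01.
    have tw : (1 - t) * dot w w <= (1 - t) * mu ^+ 2 by rewrite ler_wpM2l// subr_ge0.
    have tc : t * dot c c <= t * mu ^+ 2 by rewrite ler_wpM2l// ltW.
    rewrite !dotE (dotC c w) => cw.
    have tt : 0 <= t * (1 - t) by rewrite mulr_ge0 ?subr_ge0// ltW.
    have := mulr_ge0 tt cw; lra.
  have := wmin _ uB.
  rewrite -(ler_sqr (x := enorm _)) ?nnegrE ?sqrtr_ge0// !enorm_sqr.
  rewrite (_ : v - (w + t *: (c - w)) = (v - w) - t *: (c - w)); last first.
    by rewrite opprD addrA.
  move: (v - w) (c - w) @q h q0 @t t01 tq uB => a b q h q0 t t01 tq _.
  rewrite (dotDl a) !(dotDr _ a) !dotE (dotC b a) -/q; nra.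
have -> : v - c = (v - w) - (c - w) by rewrite opprB addrA subrK.
have -> : w - c = - (c - w) by rewrite opprB.
move: (v - w) (c - w) vwc => a b vwc.
have := dot_ge0 a.
rewrite !dotE (dotC b a); lra.
Qed.

(** * First-order estimates for convex functions with Lipschitz gradient *)

Lemma diff_dot_grad (R : realType) n (f : 'rV[R]_n -> R) (x v : 'rV[R]_n) :
  differentiable f x -> 'd f x v = dot (grad f x) v.
Proof.
move=> df; rewrite {1}(matrix_sum_delta v) big_ord1 linear_sum.
by apply: eq_bigr => i _; rewrite linearZ /= mxE deriveE// mulrC.
Qed.

Lemma is_derive_line (R : realType) n (f : 'rV[R]_n -> R) (x d : 'rV[R]_n) t :
  differentiable f (x + t *: d) ->
  is_derive t 1 (fun s : R => f (x + s *: d)) (dot (grad f (x + t *: d)) d).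
Proof.
move=> df.
have dl : is_diff t (fun s : R => x + s *: d) (fun s : R => s *: d).
  have dx : is_diff t (cst x : R -> 'rV[R]_n) 0 by exact: is_diff_cst.
  have dd : is_diff t ( *:%R ^~ d : R -> 'rV[R]_n) ( *:%R ^~ d).
    exact: is_diff_scalel.
  by have := is_diffD dx dd; rewrite add0r.
have dfl := is_diff_comp dl (differentiableP df).
have [dc dE] := dfl.
have E1 : 'd (f \o (fun s : R => x + s *: d)) t 1 = 'd f (x + t *: d) (1 *: d).
  by rewrite dE.
rewrite scale1r diff_dot_grad// in E1.
apply: DeriveDef; first exact: diff_derivable dc.
by rewrite -E1; exact: deriveE dc.
Qed.

(** The mean value theorem is applied to [g] minus the quadratic [dg 0 * t + K / 2 * t^2], whose
    difference has nonpositive derivative for [t > 0]; no integral is involved. *)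
Lemma taylor1_le (R : realType) (g dg : R -> R) (K : R) :
  (forall t : R, is_derive t 1 g (dg t)) ->
  (forall t, 0 < t -> dg t - dg 0 <= t * K) ->
  g 1 - g 0 - dg 0 <= K / 2.
Proof.
move=> dgE dgK.
pose h := fun t : R => g t - (dg 0 * t + K / 2 * t ^+ 2).
have dh (t : R) : is_derive t 1 h (dg t - (dg 0 + K * t)).
  apply: is_derive_eq.
  by rewrite /GRing.scale /=; field.
have ch : {within `[0, 1], continuous h}.
  apply: continuous_subspaceT => t.
  by apply: differentiable_continuous; apply/derivable1_diffP; case: (dh t).
have [c /itvP c01] := @MVT R h _ 0 1 ltr01 (fun t _ => dh t) ch.
have c0 : 0 < c by rewrite c01.
have := dgK _ c0.
rewrite /h; lra.
Qed.

Section smooth_convex.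
Context (R : realType) (n : nat) (L : R) (f : 'rV[R]_n -> R).
Hypotheses (L_gt0 : 0 < L) (df : forall x, differentiable f x).
Hypothesis fL : grad_lipschitz L f.

(** Young's inequality with weight [L * t], for [d] and [- d]: the Lipschitz bound makes its two
    terms on the right at most [L * t * |d|^2] each. *)
Lemma grad_lipschitz_dot (x d : 'rV[R]_n) (t : R) : 0 < t ->
  `|dot (grad f (x + t *: d)) d - dot (grad f x) d| <= t * (L * dot d d).
Proof.
move=> t0; set a := grad f (x + t *: d) - grad f x.
have aE : dot (grad f (x + t *: d)) d - dot (grad f x) d = dot a d.
  by rewrite /a !dotE.
have Lt0 : 0 < L * t by rewrite mulr_gt0.
have aL : dot a a <= (L * t) ^+ 2 * dot d d.
  have := fL (x + t *: d) x; rewrite -/a addrAC subrr add0r.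
  rewrite enorm_le ?mulr_ge0 ?sqrtr_ge0 ?(ltW L_gt0)//.
  rewrite exprMn enorm_sqr !dotE.
  lra.
have {}aL : dot a a / (L * t) <= L * t * dot d d.
  by rewrite ler_pdivrMr//; lra.
rewrite aE ler_norml.
have h1 := dot_young a d Lt0; have := dot_young a (- d) Lt0.
rewrite (dotNr a) dotNl (dotNr d) opprK => h2.
  move: (dot a a / _) aL h1 h2 => q aL h1 h2.
  apply/andP; split; lra.
Qed.

Lemma grad_lipschitz_taylor (x d : 'rV[R]_n) :
  `|f (x + d) - f x - dot (grad f x) d| <= L * dot d d / 2.
Proof.
pose g := fun s : R => f (x + s *: d).
pose dg := fun s : R => dot (grad f (x + s *: d)) d.
have gE (t : R) : is_derive t 1 g (dg t) by exact: is_derive_line.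
have gNE (t : R) : is_derive t 1 (- g) (- dg t) by exact: is_deriveN.
have dg0 : dg 0 = dot (grad f x) d by rewrite /dg scale0r addr0.
have h1 : g 1 - g 0 - dg 0 <= L * dot d d / 2.
  apply: taylor1_le => // t t0; have := grad_lipschitz_dot x d t0.
  by rewrite dg0 ler_norml => /andP[].
have h2 : (- g) 1 - (- g) 0 - - dg 0 <= L * dot d d / 2.
  apply: (@taylor1_le _ (- g) (fun t => - dg t)) => // t t0.
  have := grad_lipschitz_dot x d t0.
  by rewrite dg0 ler_norml => /andP[]; rewrite /dg; lra.
move: h1 h2; rewrite !fctE dg0 /g scale1r scale0r addr0 ler_norml => h1 h2.
by apply/andP; split; lra.
Qed.

Hypothesis fconvex : convex_function [set: 'rV[R]_n] f.

(** If the tangent at [x] exceeded [f y] by [e > 0], convexity would put [f (x + t *: d)] at least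
    [t * e] below the tangent, whereas the Taylor bound allows only [t^2 * K / 2]. *)
Lemma convex_grad (x y : 'rV[R]_n) : f x + dot (grad f x) (y - x) <= f y.
Proof.
set d := y - x; rewrite leNgt; apply/negP => h.
pose e := f x + dot (grad f x) d - f y; have e0 : 0 < e by rewrite subr_gt0.
pose K := L * dot d d; have K0 : 0 <= K by rewrite mulr_ge0 ?dot_ge0 ?ltW.
have eK : 0 < e + K by rewrite ltr_wpDr.
(* This gives [t * K <= e], hence the contradiction [e <= t * K / 2 <= e / 2]. *)
pose t := e / (e + K).
have t0 : 0 < t by rewrite divr_gt0.
have t1 : t <= 1 by rewrite ler_pdivrMr// mul1r lerDl.
have h2 : f (x + t *: d) <= f x + t * (f y - f x).
  have -> : x + t *: d = t *: y + (1 - t) *: x.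
    by rewrite /d scalerBr scalerBl scale1r addrCA.
  have := fconvex (Itv01 (ltW t0) t1) (mem_set I : y \in _) (mem_set I : x \in _).
  by rewrite convRE /= => /le_trans; apply; rewrite /unstable.onem; lra.
have := grad_lipschitz_taylor x (t *: d).
rewrite ler_norml !(dotZl, dotZr) => /andP[h1 _].
have h3 : t * e <= t * (t * K / 2) by rewrite /e /K; lra.
move: h3; rewrite ler_pM2l// => h3.
have tK : t * K <= e.
  by rewrite mulrAC ler_pdivrMr// ler_pM2l// lerDr ltW.
lra.
Qed.

(** Each coordinate of the error is the difference of the Taylor remainders at [x + e e_i] and
    [x - e e_i] divided by [2 * e]; each remainder is at most [L * e^2 / 2]. *)
Lemma fd_grad_error (x : 'rV[R]_n) (e : R) : 0 < e ->
  dot (fd_grad f x e - grad f x) (fd_grad f x e - grad f x)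
    <= n%:R * (L * e / 2) ^+ 2.
Proof.
move=> e0; set g := fd_grad f x e - grad f x.
have gi i : `|g 0 i| <= L * e / 2.
  have -> : g 0 i = (f (x + e *: delta_mx 0 i) - f (x - e *: delta_mx 0 i)) / (2 * e)
                 - dot (grad f x) (delta_mx 0 i).
    rewrite /g !mxE summxE (bigD1 i)//= big1 => [|j ji]; last first.
      by rewrite !mxE eqxx /= eq_sym (negbTE ji) mulr0.
    rewrite !mxE !eqxx mulr1 addr0 [X in X - _]mulrC; congr (_ - _).
    rewrite /dot (bigD1 i)//= big1 => [|j ji]; last first.
      by rewrite !mxE eqxx /= (negbTE ji) mulr0.
    by rewrite !mxE !eqxx mulr1 addr0.
  set v : 'rV[R]_n := delta_mx 0 i.
  have vv : dot v v = 1.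
    rewrite /dot (bigD1 i)//= big1 => [|j ji]; last first.
      by rewrite !mxE eqxx /= (negbTE ji) mulr0.
    by rewrite !mxE !eqxx mulr1 addr0.
  have := grad_lipschitz_taylor x (e *: v).
  have := grad_lipschitz_taylor x (- (e *: v)).
  rewrite !dotE vv !ler_norml => /andP[h1 h2] /andP[h3 h4].
  have e2 : 0 < 2 * e by rewrite mulr_gt0.
  rewrite lerBrDr lerBlDr ler_pdivlMr// ler_pdivrMr//; apply/andP; split; nra.
rewrite /dot -[n in n%:R]card_ord -sum1_card natr_sum big_distrl /=.
apply: ler_sum => i _; rewrite mul1r -expr2 -real_normK ?num_real//.
by rewrite ler_sqr ?nnegrE ?(le_trans _ (gi i)).
Qed.

End smooth_convex.

(** * Logarithmic increments, decay of monotone sequences with a weighted sum bound, lower limits *)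

Lemma lnB_le (R : realType) (a b : R) : 0 < a -> 0 < b ->
  ln a - ln b <= (a - b) / b.
Proof.
move=> a0 b0; rewrite -ln_div ?posrE// mulrBl divff ?gt_eqF//.
have ab : 0 < a / b by rewrite divr_gt0.
rewrite (_ : ln (a / b) = ln (1 + (a / b - 1))); last by rewrite addrC subrK.
by apply: le_ln1Dx; lra.
Qed.

(* The increments of [ln (ln (ln k))] lie below [1 / (k ln k (ln ln k))], which
   makes the latter series diverge. *)
Lemma ln3S_le (R : realType) (x : R) : 0 < x -> 0 < ln x -> 0 < ln (ln x) ->
  ln (ln (ln (x + 1))) - ln (ln (ln x)) <= (x * ln x * ln (ln x))^-1.
Proof.
move=> x0 l1 l2.
have x1 : x <= x + 1 by lra.
have l1' : ln x <= ln (x + 1) by rewrite ler_ln ?posrE//; lra.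
have l1p : 0 < ln (x + 1) by exact: lt_le_trans l1 l1'.
have l2p : 0 < ln (ln (x + 1)) by rewrite (lt_le_trans l2)// ler_ln ?posrE.
apply: le_trans (lnB_le l2p l2) _; rewrite invfM ler_pM2r ?invr_gt0//.
apply: le_trans (lnB_le l1p l1) _; rewrite invfM ler_pM2r ?invr_gt0//.
by apply: le_trans (lnB_le _ x0) _; [lra | rewrite addrAC subrr add0r mul1r].
Qed.

Section weighted_summable.
Context (R : realType) (s W : nat -> R) (c : R).
Hypotheses (c_gt0 : 0 < c) (s_ge0 : forall k, 0 <= s k).
Hypotheses (s_decr : forall k, s k.+1 <= s k) (W_ge0 : forall k, 0 <= W k).
Hypothesis sW : forall k, W k.+1 + c * (k.+1%:R * s k.+1) <= W k.

Let W_decr : {homo W : m n / (m <= n)%N >-> n <= m}.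
Proof.
apply/nonincreasing_seqP => k; apply: le_trans (sW k).
by rewrite lerDl !mulr_ge0// ltW.
Qed.

(** Telescoping [sW] over [j] indices: by monotonicity each term [i%:R * s i] with [h < i <= h + j]
    is at least [h.+1%:R * s (h + j)]. *)
Lemma weighted_summable_block h j :
  W (h + j) + c * (j%:R * h.+1%:R * s (h + j)) <= W h.
Proof.
elim: j => [|j IH]; first by rewrite addn0 !mul0r mulr0 addr0.
have := sW (h + j); rewrite addnS => hW; apply: le_trans IH.
have h1 : c * (j%:R * h.+1%:R * s (h + j).+1) <= c * (j%:R * h.+1%:R * s (h + j)).
  by rewrite ler_pM2l// ler_wpM2l ?mulr_ge0.
have h2 : c * (h.+1%:R * s (h + j).+1) <= c * ((h + j).+1%:R * s (h + j).+1).
  by rewrite ler_pM2l// ler_wpM2r// ler_nat ltnS leq_addr.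
rewrite -[j.+1]addn1 natrD; lra.
Qed.

(** The block from [m./2] to [m] gives [m^2 * s m <= (4 / c) * (W m./2 - W m)], and the right side
    vanishes because [W] converges. *)
Lemma weighted_summable_cvg : (k%:R ^+ 2 * s k) @[k --> \oo] --> (0 : R).
Proof.
have Wcvg : cvgn W.
  by apply: nonincreasing_is_cvgn => //; exists 0 => _ [k _ <-].
have half_cvg : m./2 @[m --> \oo] --> \oo.
  move=> A [N _ NA]; exists N.*2 => // m /= Nm; apply: NA => /=.
  by rewrite -[N]doubleK half_leq.
have Wh : W m./2 - W m @[m --> \oo] --> (0 : R).
  rewrite -(subrr (limn W)); apply: cvgB => //.
  exact: (cvg_comp _ _ half_cvg Wcvg).
have {}Wh : (4 / c) * (W m./2 - W m) @[m --> \oo] --> (0 : R).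
  by rewrite -(mulr0 (4 / c)); exact: cvgM (cvg_cst _) Wh.
apply: (squeeze_cvgr _ (cvg_cst (0 : R)) Wh).
apply: nearW => m; rewrite mulr_ge0 ?sqr_ge0//=.
have := weighted_summable_block m./2 (uphalf m).
have mE : (m./2 + uphalf m)%N = m by rewrite uphalf_half addnCA addnn odd_double_half.
rewrite mE => hW.
have mh : m%:R / 2 <= (m./2.+1%:R : R).
  by rewrite ler_pdivrMr// -natrM ler_nat muln2 ltnW// -ltn_half_double.
have mu : m%:R / 2 <= ((uphalf m)%:R : R).
  by rewrite ler_pdivrMr// -natrM ler_nat muln2 -leq_uphalf_double.
have m2 : (m%:R / 2) * (m%:R / 2) <= ((uphalf m)%:R * m./2.+1%:R : R).
  by apply: ler_pM => //; rewrite divr_ge0.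
have {m2} : (m%:R / 2) * (m%:R / 2) * s m <= (uphalf m)%:R * m./2.+1%:R * s m.
  by rewrite ler_wpM2r.
rewrite -(ler_pM2l c_gt0) => m2.
rewrite [leRHS]mulrAC ler_pdivlMr//; lra.
Qed.

(** Otherwise [k * s k >= e / (k ln k (ln ln k))] eventually, which dominates [e] times an increment
    of [ln (ln (ln k))]. Then [W k + c * e * l3 k.+1] is eventually nonincreasing, although [W >= 0]
    and [l3] is unbounded. *)
Lemma weighted_summable_liminf (e : R) N : 0 < e -> exists2 k, (N <= k)%N &
  k%:R ^+ 2 * ln k%:R * ln (ln k%:R) * s k < e.
Proof.
move=> e0; apply/not_exists2P => H.
have {}H k : (N <= k)%N -> e <= k%:R ^+ 2 * ln k%:R * ln (ln k%:R) * s k.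
  by move=> Nk; case: (H k) => [/(_ Nk)//|/negP]; rewrite -leNgt.
(* From [exp(e)] on, [ln k >= e] and [ln (ln k) >= 1], so all iterated logarithms are positive. *)
pose M := maxn N (Num.truncn (expR (expR 1) : R)).+1.
have exM k : (M <= k)%N -> expR (expR 1) <= k%:R :> R.
  move=> Mk; apply: le_trans (ltW (truncnS_gt _)) _.
  by rewrite ler_nat (leq_trans _ Mk)// leq_maxr.
have ln1 k : (M <= k)%N -> expR 1 <= ln k%:R :> R.
  by move=> /exM h; rewrite -[leLHS]expRK ler_ln ?posrE ?expR_gt0// (lt_le_trans _ h)// expR_gt0.
have ln2 k : (M <= k)%N -> 1 <= ln (ln k%:R) :> R.
  by move=> /ln1 h; rewrite -[leLHS]expRK ler_ln ?posrE ?expR_gt0// (lt_le_trans _ h)// expR_gt0.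
pose l3 k : R := ln (ln (ln k%:R)).
have step k : (M <= k)%N -> W k.+1 + c * e * l3 k.+2 <= W k + c * e * l3 k.+1.
  move=> Mk; have Mk1 : (M <= k.+1)%N by exact: leqW.
  set q : R := k.+1%:R; have q0 : 0 < q by rewrite ltr0n.
  have a0 : 0 < ln q by rewrite (lt_le_trans _ (ln1 _ Mk1))// expR_gt0.
  have b0 : 0 < ln (ln q) by rewrite (lt_le_trans _ (ln2 _ Mk1)).
  have := ln3S_le q0 a0 b0.
  rewrite (_ : q + 1 = k.+2%:R) -/(l3 k.+2); last by rewrite -[in RHS]addn1 natrD.
  rewrite -/(l3 k.+1) => hl.
  have hq : e / (q * ln q * ln (ln q)) <= q * s k.+1.
    rewrite ler_pdivrMr ?mulr_gt0//; have := H k.+1 (leq_trans (leq_maxl _ _) Mk1).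
    rewrite -/q; lra.
  have {}hl : e * (l3 k.+2 - l3 k.+1) <= q * s k.+1.
    by apply: le_trans hq; rewrite ler_pM2l.
  have {}hl : c * (e * (l3 k.+2 - l3 k.+1)) <= c * (q * s k.+1) by rewrite ler_pM2l.
  have := sW k; rewrite -/q; lra.
have bnd j : c * e * l3 (M + j).+1 <= W M + c * e * l3 M.+1.
  suff : W (M + j)%N + c * e * l3 (M + j).+1 <= W M + c * e * l3 M.+1.
    by have := W_ge0 (M + j)%N; lra.
  elim: j => [|j]; first by rewrite addn0.
  by rewrite addnS; apply: le_trans; apply: step; exact: leq_addr.
have ce : 0 < c * e by rewrite mulr_gt0.
(* [X] exceeds by one the bound that [bnd] puts on [l3], and [j] is large enough for
   [l3 (M + j).+1 >= X]. *)
pose X := (W M + c * e * l3 M.+1) / (c * e) + 1.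
pose j := (Num.truncn (expR (expR (expR X)))).+1.
have := bnd j; rewrite mulrC -ler_pdivlMr//; apply/negP; rewrite -ltNge.
apply: (@lt_le_trans _ _ X); first by rewrite /X ltrDl.
have h3 : expR (expR (expR X)) <= (M + j).+1%:R.
  by apply: le_trans (ltW (truncnS_gt _)) _; rewrite ler_nat leqW// leq_addl.
have h2 : expR (expR X) <= ln (M + j).+1%:R.
  by rewrite -[leLHS]expRK ler_ln ?posrE ?expR_gt0// (lt_le_trans _ h3)// expR_gt0.
have h1 : expR X <= ln (ln (M + j).+1%:R).
  by rewrite -[leLHS]expRK ler_ln ?posrE ?expR_gt0// (lt_le_trans _ h2)// expR_gt0.
by rewrite -[leLHS]expRK ler_ln ?posrE ?expR_gt0// (lt_le_trans _ h1)// expR_gt0.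
Qed.

End weighted_summable.

(** The lower limit is the supremum of the tail infima. Nonnegativity is asked only from [N0] on
    because the weight containing [ln (ln k)] is negative at [k = 2]. *)
Lemma limn_einf_eq0 (R : realType) (u : nat -> R) (N0 : nat) :
  (forall k, (N0 <= k)%N -> 0 <= u k) ->
  (forall (e : R) N, 0 < e -> exists2 k, (N <= k)%N & u k < e) ->
  limn_einf (fun k => (u k)%:E) = 0%E.
Proof.
move=> u0 ue; rewrite limn_einf_lim; set v := fun k => (u k)%:E.
have -> : limn (einfs v) = ereal_sup (range (einfs v)).
  by apply: cvg_lim => //; exact: cvg_einfs_sup.
apply/eqP; rewrite eq_le; apply/andP; split.
  apply: ge_ereal_sup => _ [N _ <-]; apply/lee_addgt0Pr => e e0.
  have [k Nk uk] := ue _ N e0.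
  apply: (@le_trans _ _ (v k)); last by rewrite add0e lee_fin ltW.
  by apply: ereal_inf_lbound; exists k.
apply: (@le_trans _ _ (einfs v N0)); last by apply: ereal_sup_ubound; exists N0.
by apply: le_ereal_inf_tmp => _ [k /= Nk <-]; rewrite lee_fin u0.
Qed.

(** * Descent estimates and Lyapunov analysis of a run *)

(** Since [2 * L * eta <= 1], the quadratic Taylor term is at most [eta * |g|^2]; completing the
    square with [- 2 * eta * dot G g], where [G = grad f x], gives the two last terms. *)
Lemma grad_step_descent (R : realType) (n : nat) (L : R) (f : 'rV[R]_n -> R)
    (eta : R) (x g : 'rV[R]_n) :
  0 < L -> (forall x, differentiable f x) -> grad_lipschitz L f ->
  0 < eta <= (2 * L)^-1 ->
  f (x - (2 * eta) *: g) <= f x - eta * dot (grad f x) (grad f x)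
    + eta * dot (g - grad f x) (g - grad f x).
Proof.
move=> L0 df fL /andP[eta0 etaL].
have := grad_lipschitz_taylor L0 df fL x (- ((2 * eta) *: g)).
rewrite ler_norml => /andP[_].
move: (grad f x) => G.
rewrite !dotE (dotC g G) => h.
have Le : 2 * L * eta <= 1.
  by rewrite mulrC -ler_pdivlMr ?mulr_gt0// div1r.
have gg : 0 <= eta * dot g g by rewrite mulr_ge0 ?dot_ge0 ?ltW.
have : 2 * L * eta * (eta * dot g g) <= eta * dot g g by rewrite ler_piMl.
lra.
Qed.

Section nsa_rate.
Context (R : realType) (n : nat) (L : R) (f : 'rV[R]_n -> R).
Hypotheses (L_gt0 : 0 < L) (df : forall x, differentiable f x).
Hypotheses (fL : grad_lipschitz L f).
Hypothesis fconvex : convex_function [set: 'rV[R]_n] f.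
Context (eta p mu : R) (xs : 'rV[R]_n) (x y z : nat -> 'rV[R]_n).
Hypotheses (eta_bounds : 0 < eta <= (2 * L)^-1) (p_ge3 : 3 <= p).
Hypotheses (mu_ge0 : 0 <= mu) (xs_ball : eball n mu xs).
Hypothesis xs_min : forall u, f xs <= f u.
Hypothesis run :
  nsa_run f eta mu (fun k => p / (k%:R + p)) (fun k => 2 ^- k) x y z.

(** [E k] is the finite-difference increment, [q k] is [p / alpha_k], and [C * E k ^+ 2] bounds the
    squared error of the gradient estimate. *)
Let E (k : nat) : R := 2 ^- k.
Let q (k : nat) : R := k%:R + p.
Let C : R := n%:R * (L / 2) ^+ 2.
Let gap (k : nat) : R := f (x k) - f xs.
Let D (k : nat) : R := dot (z k - xs) (z k - xs).

Let eta_gt0 : 0 < eta. Proof. by case/andP: eta_bounds. Qed.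

Let E_gt0 k : 0 < E k. Proof. by rewrite invr_gt0 exprn_gt0. Qed.

Let ES k : E k.+1 = E k / 2.
Proof. by rewrite /E exprS invfM mulrC. Qed.

Let E_le1 k : E k <= 1.
Proof. by rewrite invf_le1 ?exprn_gt0// exprn_ege1// ler1n. Qed.

Let qS k : q k.+1 = q k + 1.
Proof. by rewrite /q -addn1 natrD addrAC. Qed.

Let q_ge3 k : 3 <= q k.
Proof. by rewrite (le_trans p_ge3)// lerDr. Qed.

Let C_ge0 : 0 <= C. Proof. by rewrite mulr_ge0 ?sqr_ge0. Qed.

Let gap_ge0 k : 0 <= gap k. Proof. by rewrite subr_ge0. Qed.

Let fd_error u k :
  dot (fd_grad f u (E k) - grad f u) (fd_grad f u (E k) - grad f u)
    <= C * E k ^+ 2.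
Proof. by have := fd_grad_error L_gt0 df fL u (E_gt0 k); rewrite /C; lra. Qed.

(** The selection rule makes [f (x k.+1)] the smaller of the two candidate values, so descent holds
    relative to [x k] here and to [y k] in [gapS_le_y]. *)
Let gapS_le_x k : gap k.+1 <= gap k + eta * C * E k ^+ 2.
Proof.
have := grad_step_descent (x k) (fd_grad f (x k) (E k)) L_gt0 df fL eta_bounds.
have := ler_wpM2l (ltW eta_gt0) (fd_error (x k) k).
have := mulr_ge0 (ltW eta_gt0) (dot_ge0 (grad f (x k))).
have : f (x k.+1) <= f (x k - (2 * eta) *: fd_grad f (x k) (E k)).
  by rewrite (nsa_x run); case: ifPn.
rewrite /gap; lra.
Qed.

Let gapS_le_y k : gap k.+1 <= f (y k) - f xs
  - eta * dot (grad f (y k)) (grad f (y k)) + eta * C * E k ^+ 2.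
Proof.
have := grad_step_descent (y k) (fd_grad f (y k) (E k)) L_gt0 df fL eta_bounds.
have := ler_wpM2l (ltW eta_gt0) (fd_error (y k) k).
have : f (x k.+1) <= f (y k - (2 * eta) *: fd_grad f (y k) (E k)).
  by rewrite (nsa_x run); case: ifPn => //; rewrite -ltNge => /ltW.
rewrite /gap; lra.
Qed.

(** From index 1 on, [z k] and [xs] both lie in the ball, so [D k <= 4 * mu^2]; the starting point
    may lie outside, whence the summand [D 0]. *)
Let D_bounded k : D k <= D 0 + 4 * mu ^+ 2.
Proof.
have D0 : 0 <= D 0 by exact: dot_ge0.
have m0 : 0 <= mu ^+ 2 by exact: sqr_ge0.
case: k => [|k]; first by lra.
move: (D 0) D0 => d0 d0_ge0.
have [zB _] := nsa_z run k.
move: zB xs_ball; rewrite /eball /= !enorm_le// => zB xB.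
have := dot_young (z k.+1) (- xs) (@ltr01 R).
by rewrite divr1 mul1r !dotE opprK /D !dotE (dotC xs); lra.
Qed.

Let grad_y_lower k :
  q k * (f (y k) - f xs) - k%:R * gap k
    <= p * dot (grad f (y k)) (z k - xs).
Proof.
have q0 : 0 < q k by apply: lt_le_trans (q_ge3 k).
have p0 : 0 < p by apply: lt_le_trans p_ge3.
have k0 : 0 <= k%:R :> R by [].
have yE : q k *: y k = k%:R *: x k + p *: z k.
  rewrite (nsa_y run) scalerDr !scalerA -/(q k); congr (_ *: _ + _ *: _).
    by rewrite mulrBr mulr1 mulrCA divff ?gt_eqF// mulr1 /q addrK.
  by rewrite mulrCA divff ?gt_eqF// mulr1.
(* By [yE], [p (z - xs) = - (k (x - y) + p (xs - y))]; the gradient inequality at [y k] then applies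
   to both [x k] and [xs]. *)
have -> : p * dot (grad f (y k)) (z k - xs) =
    - (k%:R * dot (grad f (y k)) (x k - y k) + p * dot (grad f (y k)) (xs - y k)).
  have := congr1 (dot (grad f (y k))) yE; rewrite !dotE /q; lra.
have h1 := ler_wpM2l k0 (convex_grad L_gt0 df fL fconvex (y k) (x k)).
have h2 := ler_wpM2l (ltW p0) (convex_grad L_gt0 df fL fconvex (y k) xs).
rewrite /gap /q; lra.
Qed.

(** The first summand bounds the pairing of the gradient error with [z k - xs], the second the
    squared gradient errors. *)
Let K : R := p * eta * (C + D 0 + 4 * mu ^+ 2) + 4 * eta ^+ 2 * C.

(** Expanding the projected step leaves [eta^2 * q^2 * |g|^2], where [|g|^2 <= 2 * |G|^2] up to
    error. The [|G|^2] part cancels exactly against [2 * eta * q^2] times the descent from [y k],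
    and [grad_y_lower] cancels [f (y k)]. *)
Let lyapunov_step k :
  2 * eta * q k ^+ 2 * gap k.+1 + p ^+ 2 * D k.+1
    <= 2 * eta * (k%:R * q k) * gap k + p ^+ 2 * D k + K * (E k * q k ^+ 2).
Proof.
have q0 : 0 < q k by apply: lt_le_trans (q_ge3 k).
have p0 : 0 < p by apply: lt_le_trans p_ge3.
have q1 : 1 <= q k by have := q_ge3 k; lra.
set G := grad f (y k); set g := fd_grad f (y k) (E k); set w := z k - xs.
have proj : D k.+1 <=
    D k - 2 * (eta * q k / p) * dot g w + (eta * q k / p) ^+ 2 * dot g g.
  have := eproj_nonexpansive mu_ge0 xs_ball (nsa_z run k).
  rewrite -/(E k) -/(q k) -/g invf_div (mulrA eta) /D addrAC -/w.
  by rewrite dot_subZ.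
have {}proj : p ^+ 2 * D k.+1 <= p ^+ 2 * D k
    - 2 * eta * q k * (p * dot g w) + eta ^+ 2 * q k ^+ 2 * dot g g.
  have := ler_wpM2l (sqr_ge0 p) proj.
  have -> : p ^+ 2 * (D k - 2 * (eta * q k / p) * dot g w + (eta * q k / p) ^+ 2 * dot g g)
    = p ^+ 2 * D k - 2 * eta * q k * (p * dot g w) + eta ^+ 2 * q k ^+ 2 * dot g g.
    by field; rewrite gt_eqF.
  by [].
have gE : g = G + (g - G) by rewrite addrC subrK.
have eC := fd_error (y k) k; rewrite -/g -/G in eC.
(* Young's inequality with weight [E k] balances a squared error of order [E k ^+ 2] against the
   bounded [D k], leaving order [E k]. *)
have err : - (2 * dot (g - G) w) <= E k * (C + D 0 + 4 * mu ^+ 2).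
  have h := dot_young (- (g - G)) w (E_gt0 k).
  have hD := ler_wpM2l (ltW (E_gt0 k)) (D_bounded k).
  have hC : dot (g - G) (g - G) / E k <= C * E k.
    by rewrite ler_pdivrMr// -mulrA -expr2.
  move: h; rewrite !(dotNl, dotNr) opprK; move: hD; rewrite /D -/w; lra.
have gg : dot g g <= 2 * dot G G + 2 * (C * E k ^+ 2).
  have := dot_young G (g - G) (@ltr01 R); rewrite divr1 mul1r.
  have := dot_sqrD G (g - G); rewrite -gE; lra.
have low := grad_y_lower k; rewrite -/G -/w in low.
have up := gapS_le_y k; rewrite -/G in up.
have gw : dot g w = dot G w + dot (g - G) w by rewrite {1}gE dotDl.
have eq0 : 0 < eta * q k by rewrite mulr_gt0.
have t1 := ler_wpM2l (ltW eq0) low.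
have t2 := ler_wpM2l (mulr_ge0 (ltW eq0) (ltW p0)) err.
have t3 := ler_wpM2l (sqr_ge0 (eta * q k)) gg.
have t4 := ler_wpM2l (mulr_ge0 (ltW eq0) (ltW q0)) up.
have Eq : E k * q k <= E k * q k ^+ 2.
  by rewrite ler_pM2l// expr2 ler_peMl// ltW.
have EE : E k ^+ 2 * q k ^+ 2 <= E k * q k ^+ 2.
  by rewrite ler_wpM2r ?sqr_ge0// expr2 ler_piMl// ltW.
have B0 : 0 <= p * eta * (C + D 0 + 4 * mu ^+ 2).
  apply: mulr_ge0; first by rewrite mulr_ge0// ltW.
  by rewrite !addr_ge0 ?dot_ge0// mulr_ge0// sqr_ge0.
have C0 : 0 <= 4 * eta ^+ 2 * C by rewrite mulr_ge0// mulr_ge0// sqr_ge0.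
have t5 := ler_wpM2l B0 Eq.
have t6 := ler_wpM2l C0 EE.
rewrite /K; rewrite gw in proj; lra.
Qed.

(* [T k] is the tail of the series of the errors [2 ^- j * (j + p) ^+ 2], so adding
   a multiple of it to the Lyapunov function absorbs these errors. *)
Let T k : R := E k * (2 * q k ^+ 2 + 4 * q k + 6).

Let TS k : T k.+1 = T k - E k * q k ^+ 2.
Proof. by rewrite /T ES qS; field. Qed.

(** Since [E k ^+ 2] shrinks by the factor 4, the correction in [s] drops by
    [3 / 2 * eta * C * E k ^+ 2], enough to absorb the error in [gapS_le_x]. *)
Let c1 : R := 2 * eta * C.
Let s k : R := gap k + c1 * E k ^+ 2.
(** The part [2 * eta * c1] of the coefficient of [T k] pays for the excess of [s] over [gap] in
    [sW]. *)
Let W k : R := 2 * eta * (k%:R * q k) * gap k + p ^+ 2 * D k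
  + (K + 2 * eta * c1) * T k.

Let K_ge0 : 0 <= K.
Proof.
have p0 : 0 < p by apply: lt_le_trans p_ge3.
apply: addr_ge0; last by rewrite mulr_ge0// mulr_ge0// sqr_ge0.
apply: mulr_ge0; first by rewrite mulr_ge0// ltW.
by rewrite !addr_ge0 ?dot_ge0// mulr_ge0// sqr_ge0.
Qed.

Let c1_ge0 : 0 <= c1.
Proof. by rewrite !mulr_ge0// ltW. Qed.

Let s_ge0 k : 0 <= s k.
Proof. by rewrite addr_ge0// mulr_ge0// sqr_ge0. Qed.

Let s_decr k : s k.+1 <= s k.
Proof.
have := gapS_le_x k; rewrite /s ES.
have : 0 <= c1 * E k ^+ 2 by rewrite mulr_ge0// sqr_ge0.
rewrite /c1; lra.
Qed.

Let W_ge0 k : 0 <= W k.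
Proof.
have q0 : 0 <= q k by apply: le_trans (q_ge3 k).
have e2 : 0 <= 2 * eta by rewrite mulr_ge0// ltW.
apply: addr_ge0; first apply: addr_ge0.
- by rewrite mulr_ge0// mulr_ge0// mulr_ge0.
- by rewrite mulr_ge0 ?sqr_ge0 ?dot_ge0.
- apply: mulr_ge0; first by rewrite addr_ge0// mulr_ge0.
  apply: mulr_ge0; first exact: ltW.
  by rewrite !addr_ge0// mulr_ge0// sqr_ge0.
Qed.

Let sW k : W k.+1 + 2 * eta * (k.+1%:R * s k.+1) <= W k.
Proof.
have hL := lyapunov_step k.
have k0 : 0 <= k%:R :> R by [].
have kS : k.+1%:R = k%:R + 1 :> R by rewrite -addn1 natrD.
(* Here [p >= 3] enters: [q k ^+ 2 - (k + 1) (k + p + 2) = (p - 3) k + (p - 2) (p + 1)]. The extra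
   [k + 1] is the summable surplus. *)
have h1 : 2 * eta * (k.+1%:R * q k.+1 + k.+1%:R) * gap k.+1
    <= 2 * eta * q k ^+ 2 * gap k.+1.
  rewrite ler_wpM2r// ler_pM2l ?mulr_gt0// qS kS /q.
  have := p_ge3; nra.
have h2 : k.+1%:R * E k.+1 ^+ 2 <= E k * q k ^+ 2.
  rewrite ES kS; have e0 := E_gt0 k; have e1 := E_le1 k.
  have EE : E k ^+ 2 <= E k by rewrite expr2 ler_piMl// ltW.
  have kq : k%:R + 1 <= q k ^+ 2.
    have := q_ge3 k; have : k%:R + 1 <= q k by rewrite /q; have := p_ge3; lra.
    nra.
  have := ler_pM (addr_ge0 k0 ler01) (sqr_ge0 (E k)) kq EE.
  have : 0 <= E k ^+ 2 * (k%:R + 1) by rewrite mulr_ge0 ?sqr_ge0 ?addr_ge0.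
  lra.
have h3 := ler_wpM2l (mulr_ge0 (mulr_ge0 (ler0n R 2) (ltW eta_gt0)) c1_ge0) h2.
rewrite /W /s TS; lra.
Qed.

Let gap_le_s k : gap k <= s k.
Proof. by rewrite lerDl mulr_ge0// sqr_ge0. Qed.

Lemma nsa_gap_cvg : (k%:R ^+ 2 * (f (x k) - f xs)) @[k --> \oo] --> (0 : R).
Proof.
have c0 : 0 < 2 * eta by rewrite mulr_gt0.
have := weighted_summable_cvg c0 s_ge0 s_decr W_ge0 sW.
apply: squeeze_cvgr (cvg_cst (0 : R)).
apply: nearW => k; rewrite -/(gap k) mulr_ge0 ?sqr_ge0//=.
by rewrite ler_wpM2l ?sqr_ge0.
Qed.

Lemma nsa_gap_liminf :
  limn_einf (fun k => (k%:R ^+ 2 * ln k%:R * ln (ln k%:R)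
                         * (f (x k) - f xs))%:E) = 0%E.
Proof.
(* For [k >= e] one has [ln k >= 1], so the weight is nonnegative and [gap k <= s k] may be
   multiplied by it. *)
pose N0 := (Num.truncn (expR 1 : R)).+1.
have w_ge0 k : (N0 <= k)%N -> 0 <= k%:R ^+ 2 * ln k%:R * ln (ln k%:R) :> R.
  move=> Nk; have ek : expR 1 <= k%:R :> R.
    by rewrite (le_trans (ltW (truncnS_gt _)))// ler_nat.
  have l1 : 1 <= ln k%:R :> R.
    by rewrite -[leLHS]expRK ler_ln ?posrE ?expR_gt0// (lt_le_trans _ ek)// expR_gt0.
  have l0 : 0 <= ln k%:R :> R by apply: le_trans l1.
  by rewrite mulr_ge0 ?ln_ge0// mulr_ge0 ?sqr_ge0.
apply: (@limn_einf_eq0 _ _ N0) => [k Nk|e N e0].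
  by rewrite -/(gap k) mulr_ge0 ?w_ge0.
have c0 : 0 < 2 * eta by rewrite mulr_gt0.
have [k Nk sk] := weighted_summable_liminf c0 W_ge0 sW (maxn N N0) e0.
exists k; first exact: leq_trans (leq_maxl _ _) Nk.
apply: le_lt_trans sk; rewrite -/(gap k) ler_wpM2l ?w_ge0//.
exact: leq_trans (leq_maxr _ _) Nk.
Qed.

End nsa_rate.

Theorem corollary1 (R : realType) (n : nat) (hn : (1 <= n)%N)
  (L : R) (hL : 0 < L)
  (f : 'rV[R]_n -> R)
  (fconvex : convex_function [set: 'rV[R]_n] f)
  (fC1 : C1 f)
  (fL : grad_lipschitz L f)
  (eta : R) (heta : 0 < eta <= (2 * L)^-1)
  (p : R) (hp : 3 <= p)
  (mu : R) (hmu : 0 < mu)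
  (xs : 'rV[R]_n) (xs_ball : eball n mu xs) (xs_min : forall u, f xs <= f u)
  (x y z : nat -> 'rV[R]_n)
  (hrun : nsa_run f eta mu (fun k => p / (k%:R + p)) (fun k => 2 ^- k) x y z) :
  (exists beta : R, 1 < beta /\
     limn_einf (fun k => (beta ^+ k * enorm (grad f (x k)))%:E) = 0%E)
  \/
  (limn_esup (fun k => (k%:R ^+ 2 * (f (x k) - f xs))%:E) = 0%E /\
   limn_einf (fun k => (k%:R ^+ 2 * ln k%:R * ln (ln k%:R)
                          * (f (x k) - f xs))%:E) = 0%E).
Proof.
case: fC1 => df _; right; split.
  (* An actual limit in the extended reals determines the upper limit. *)
  have gap_cvg : ((k%:R ^+ 2 * (f (x k) - f xs))%:E @[k --> \oo] --> 0%:E)%classic.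
    have := nsa_gap_cvg hL df fL fconvex heta hp (ltW hmu) xs_ball xs_min hrun.
    by move=> h; apply: cvg_EFin; [exact: nearW | exact: h].
  by have [_ ->] := cvg_limn_einf_sup gap_cvg.
exact: (nsa_gap_liminf hL df fL fconvex heta hp (ltW hmu) xs_ball xs_min hrun).
Qed.
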